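(* Let $t\in\mathbb{R}$ and let $A,B\in\mathbb{B}(\mathscr{H})$. (i) If $0<t\le 1$, then $$|A\mp B|^2+|tA\pm B|^2\le(1+t)|A|^2+\left(1+\frac1t\right)|B|^2.$$ (ii) If $t\ge 1$ or $t<0$, then $$|A\mp B|^2+|tA\pm B|^2\ge(1+t)|A|^2+\left(1+\frac1t\right)|B|^2.$$
   Context: $\mathbb{B}(\mathscr{H})$ is the algebra of all bounded linear operators on a complex (separable) Hilbert space $\mathscr{H}$; $|C|=(C^*C)^{1/2}$ for $C\in\mathbb{B}(\mathscr{H})$; $\le$ is the usual order on self-adjoint operators. In each inequality the signs are read consistently: either all upper signs or all lower signs are taken, and both versions are asserted. *)

(* Defs.v *)
From HB Require Import structures.
From mathcomp Require Import all_boot all_order all_algebra.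
From mathcomp Require Import complex.
From mathcomp Require Import all_classical all_reals all_analysis.

Set Implicit Arguments.
Unset Strict Implicit.
Unset Printing Implicit Defensive.
Import Order.TTheory GRing.Theory Num.Theory.
Import numFieldNormedType.Exports.

Local Open Scope classical_set_scope.
Local Open Scope ring_scope.
Local Open Scope complex_scope.

(* The inner product is linear in its first argument and conjugate-linear in
   the second one. *)
HB.mixin Record CompleteNormedModule_isHilbert (R : realType) (H : Type)
    & CompleteNormedModule R[i] H := {
  inner : {dot H for (Num.conj : R[i] -> R[i])};
  inner_normE : forall x : H, inner x x = `|x| ^+ 2
}.

#[short(type="hilbertType")]
HB.structure Definition Hilbert (R : realType) :=
  {H of CompleteNormedModule_isHilbert R H & CompleteNormedModule R[i] H}.

Definition separable_space (T : topologicalType) :=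
  exists2 D : set T, countable D & dense D.

Section BoundedOperators.
Context {R : realType} {H : hilbertType R}.
Implicit Types A C S T : H -> H.

Definition bounded_operator A :=
  linear A /\ exists M : R, forall x, `|A x| <= M%:C * `|x|.

(* By the Riesz representation theorem, every bounded operator has exactly one
   adjoint; the default value 0 is only taken outside B(H). *)
Definition adjoint A : H -> H :=
  xget 0 [set A' | bounded_operator A' /\
                   forall x y, inner (A x) y = inner x (A' y)].

Definition self_adjoint A := bounded_operator A /\ adjoint A = A.

(* [0 <= z] in R[i] means that z is a nonnegative real. *)
Definition positive_operator A :=
  self_adjoint A /\ forall x, 0 <= inner (A x) x.

Definition operator_le S T :=
  [/\ self_adjoint S, self_adjoint T & positive_operator (T - S)].

(* Every positive operator has exactly one positive square root; the default
   value 0 is only taken on non-positive operators. *)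
Definition sqrt_operator T : H -> H :=
  xget 0 [set S | positive_operator S /\ S \o S = T].

Definition abs_operator C := sqrt_operator (adjoint C \o C).

Definition sqr_operator S := S \o S.

End BoundedOperators.

(* Main.v *)
Require Import Defs.
From mathcomp Require Import all_boot all_order all_algebra.
From mathcomp Require Import complex.
From mathcomp Require Import all_classical all_reals all_analysis.
From mathcomp Require Import ring lra.

Set Implicit Arguments.
Unset Strict Implicit.
Unset Printing Implicit Defensive.
Import Order.TTheory GRing.Theory Num.Theory.
Import numFieldNormedType.Exports.

Local Open Scope classical_set_scope.
Local Open Scope ring_scope.
Local Open Scope complex_scope.

(** Evaluating the quadratic forms of both sides at a vector x, with a = A x and
b = B x, reduces the upper-sign inequalities to the identity
(1 + t) |a|^2 + (1 + 1/t) |b|^2 - |a - b|^2 - |t a + b|^2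
  = (1 - t) / t * |t a + b|^2
([sqr_rnorm_defect]): the right-hand side is nonnegative for 0 < t <= 1 and
nonpositive for t >= 1 or t < 0. The lower signs follow by replacing B with - B.

The reduction rests on |C|^2 = C* C ([sqr_abs_operator]), that is, on the
existence of adjoints and of square roots.

Adjoints come from the Riesz representation theorem ([real_riesz]): a bounded
functional phi is represented by the limit of a minimizing sequence of
|u|^2 - 2 phi u.

For the square root, C* C is scaled to the form 1 - A with A a self-adjoint
contraction, and the root is 1 - Z with Z a solution of 2 Z = A + Z^2. The
iteration Y' = (A + Y^2) / 2 starting at 0 converges to Z in operator norm:
its increments are dominated by those of the numerical sequence
y' = (1 + y^2) / 2, which is nondecreasing and bounded by 1
([sqrt_iter_step], [contraction_fixpoint]). *)

(** * The underlying real inner product *)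
Section RealPart.
Context {R : realType} {H : hilbertType R}.
Implicit Types (x y z : H) (s : R).

(** Estimates are carried out with the real part of the inner product, so that
they take place in the totally ordered field R instead of R[i]; no information
is lost, since Im z = - Re (i z). *)
Definition rinner x y : R := complex.Re (inner x y).
Definition rnorm x : R := complex.Re `|x|.

Lemma norm_rnormE x : `|x| = (rnorm x)%:C.
Proof.
rewrite /rnorm; have := normr_ge0 x; rewrite lecE /= => /andP[/eqP e _].
by move: e; case: (`|x|) => a b /= ->.
Qed.

Lemma rnorm_ge0 x : 0 <= rnorm x.
Proof. by have := normr_ge0 x; rewrite norm_rnormE lecR. Qed.

Lemma rnorm_eq0 x : rnorm x = 0 -> x = 0.
Proof. by move=> e; apply/normr0_eq0; rewrite norm_rnormE e. Qed.

Lemma rnorm0 : rnorm 0 = 0.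
Proof. by rewrite /rnorm normr0. Qed.

Lemma rnormD x y : rnorm (x + y) <= rnorm x + rnorm y.
Proof. by rewrite -lecR rmorphD /= -!norm_rnormE ler_normD. Qed.

Lemma rnormN x : rnorm (- x) = rnorm x.
Proof. by rewrite /rnorm normrN. Qed.

Lemma rnormBC x y : rnorm (x - y) = rnorm (y - x).
Proof. by rewrite -rnormN opprB. Qed.

Lemma rnormZC (a : R[i]) x : rnorm (a *: x) = complex.Re `|a| * rnorm x.
Proof.
rewrite {1}/rnorm normrZ norm_rnormE normc_def /=; ring.
Qed.

Lemma rnormZ s x : rnorm (s%:C *: x) = `|s| * rnorm x.
Proof. by rewrite rnormZC normc_def /= expr0n addr0 sqrtr_sqr. Qed.

(** Equalities of limits are proved through this criterion: the bound K is a
fixed multiple of a fixed norm, and e is the accuracy of an approximation. *)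
Lemma rnorm_eq0_small x (K : R) :
  (forall e : R, 0 < e -> rnorm x <= e * K) -> x = 0.
Proof.
move=> h; apply: rnorm_eq0; apply/eqP; rewrite eq_le rnorm_ge0 andbT.
apply/ler_addgt0Pr => e e0; rewrite add0r.
have K0 : 0 < `|K| + 1 by rewrite ltr_wpDl.
apply: le_trans (h (e / (`|K| + 1)) (divr_gt0 e0 K0)) _.
rewrite -mulrA ger_pMr // ler_pdivrMl // mulr1.
by rewrite (le_trans (ler_norm _)) // lerDl.
Qed.

Lemma rinnerxx x : rinner x x = rnorm x ^+ 2.
Proof. by rewrite /rinner inner_normE norm_rnormE -rmorphXn. Qed.

Lemma rinnerDl x y z : rinner (x + y) z = rinner x z + rinner y z.
Proof. by rewrite /rinner linearDl raddfD. Qed.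

Lemma rinnerNl x z : rinner (- x) z = - rinner x z.
Proof. by rewrite /rinner linearNl raddfN. Qed.

Lemma rinnerZl s x z : rinner (s%:C *: x) z = s * rinner x z.
Proof.
rewrite /rinner linearZl_LR /=; case: (inner x z) => a b /=; ring.
Qed.

Lemma innerC x y : inner x y = (inner y x)^*.
Proof. by rewrite hermC mul1r. Qed.

Lemma rinnerC x y : rinner x y = rinner y x.
Proof. by rewrite /rinner innerC; case: (inner y x). Qed.

Lemma rinnerDr x y z : rinner x (y + z) = rinner x y + rinner x z.
Proof. by rewrite ![rinner x _]rinnerC rinnerDl. Qed.

Lemma rinnerNr x z : rinner x (- z) = - rinner x z.
Proof. by rewrite ![rinner x _]rinnerC rinnerNl. Qed.

Lemma rinnerZr s x z : rinner x (s%:C *: z) = s * rinner x z.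
Proof. by rewrite ![rinner x _]rinnerC rinnerZl. Qed.

Lemma rnormD_sqr x y :
  rnorm (x + y) ^+ 2 = rnorm x ^+ 2 + 2 * rinner x y + rnorm y ^+ 2.
Proof.
by rewrite -!rinnerxx rinnerDl !rinnerDr (rinnerC y x); ring.
Qed.

Lemma Re_mul_i (w : R[i]) : complex.Re ('i%C * w) = - complex.Im w.
Proof. by case: w => a b /=; ring. Qed.

(** The discriminant criterion, used both for the Cauchy-Schwarz inequality and
for the near-minimizers of a quadratic functional. *)
Lemma sqr_le_nonneg_quadratic (a b c : R) : 0 <= c ->
  (forall s, 0 <= a + 2 * s * b + s ^+ 2 * c) -> b ^+ 2 <= a * c.
Proof.
move=> c0 h; have [c1|c1] := eqVneq c 0.
  rewrite c1 mulr0; have [->|b0] := eqVneq b 0; first by rewrite expr0n.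
  have := h (- (a + 1) / (2 * b)); rewrite c1.
  have -> : a + 2 * (- (a + 1) / (2 * b)) * b
              + (- (a + 1) / (2 * b)) ^+ 2 * 0 = -1 by field.
  by rewrite oppr_ge0 ler10.
have c2 : 0 < c by rewrite lt_def c1.
have := h (- b / c).
have -> : a + 2 * (- b / c) * b + (- b / c) ^+ 2 * c = (a * c - b ^+ 2) / c.
  by field.
by rewrite ler_pdivlMr // mul0r subr_ge0.
Qed.

Lemma rinner_le x y : `|rinner x y| <= rnorm x * rnorm y.
Proof.
rewrite -ler_sqr ?nnegrE ?mulr_ge0 ?rnorm_ge0 //.
rewrite real_normK ?num_real // exprMn; apply: sqr_le_nonneg_quadratic => [|s].
  exact: sqr_ge0.
have := sqr_ge0 (rnorm (x + s%:C *: y)).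
rewrite rnormD_sqr rinnerZr rnormZ exprMn real_normK ?num_real //; lra.
Qed.

Lemma rinner_inj x y : (forall z, rinner z x = rinner z y) -> x = y.
Proof.
move=> e; apply/eqP; rewrite -subr_eq0; apply/eqP/rnorm_eq0/eqP.
by rewrite -sqrf_eq0 -rinnerxx rinnerDr rinnerNr e subrr.
Qed.

(** The imaginary part of f x is minus the real part of f (i x). *)
Lemma eq_Re_linear (f g : H -> R[i]) :
    (forall x, f ('i%C *: x) = 'i%C * f x) ->
    (forall x, g ('i%C *: x) = 'i%C * g x) ->
  (forall x, complex.Re (f x) = complex.Re (g x)) -> f =1 g.
Proof.
move=> fi gi e x; have := e ('i%C *: x); rewrite fi gi !Re_mul_i => /oppr_inj.
by have := e x; case: (f x) (g x) => a b [c d] /= -> ->.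
Qed.

End RealPart.

(** * Completeness in terms of real-valued norms *)
Section Limits.
Context {R : realType} {H : hilbertType R}.
Implicit Types (u : nat -> H) (l : H).

Definition converges u l := forall e : R, 0 < e ->
  exists N, forall n, (N <= n)%N -> rnorm (u n - l) <= e.

Lemma rnorm_cauchy_converges u :
  (forall e : R, 0 < e -> exists N, forall n, (N <= n)%N ->
    rnorm (u n - u N) <= e) -> exists l, converges u l.
Proof.
move=> hu; have cu : cvg (u @ \oo).
  apply/cauchy_cvgP/cauchy_exP => e e0.
  have [d d0 de] : exists2 d : R, 0 < d & d%:C < e.
    move: e0; case: e => a b; rewrite ltcE /= => /andP[/eqP -> a0].
    by exists (a / 2); [lra | rewrite ltcR; lra].
  have [N hN] := hu d d0.
  exists (u N); exists N => // n /= Nn.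
  by rewrite -ball_normE /ball_ /= distrC norm_rnormE (le_lt_trans _ de) // lecR hN.
exists (lim (u @ \oo)) => e e0.
have /cvgrPdist_le/(_ (e%:C)) := cu; rewrite ltcR => /(_ e0)[N _ hN].
by exists N => n Nn; rewrite rnormBC -lecR -norm_rnormE; apply: hN.
Qed.

End Limits.

(** * Riesz representation *)
Section Riesz.
Context {R : realType} {H : hilbertType R}.
Implicit Types (x y z : H) (s : R).

(** Quantitative form of the Euler equation: an exact minimizer of
|u|^2 - 2 phi u represents phi, because the derivative of the functional at x
in the direction h is 2 (rinner x h - phi h). At a point x whose value is
within e^2 of the infimum, the quadratic polynomial in s obtained by moving
along s h is at least - e^2, and the discriminant criterion bounds this
derivative by e |h|. *)
Lemma minimizer_Euler (phi : H -> R) (m e : R) x h :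
    (forall u v, phi (u + v) = phi u + phi v) ->
    (forall s u, phi (s%:C *: u) = s * phi u) ->
    (forall u, m <= rnorm u ^+ 2 - 2 * phi u) ->
    0 <= e -> rnorm x ^+ 2 - 2 * phi x <= m + e ^+ 2 ->
  `|rinner x h - phi h| <= e * rnorm h.
Proof.
move=> phiD phiZ hm e0 hx.
rewrite -ler_sqr ?nnegrE ?mulr_ge0 ?rnorm_ge0 //.
rewrite real_normK ?num_real // exprMn; apply: sqr_le_nonneg_quadratic => [|s].
  exact: sqr_ge0.
have := hm (x + s%:C *: h).
rewrite phiD phiZ rnormD_sqr rinnerZr rnormZ exprMn real_normK ?num_real //.
lra.
Qed.

(** A minimizing sequence of |u|^2 - 2 phi u is Cauchy: applying the approximate
Euler equation at u n and u N in the direction h := u n - u N and subtracting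
gives |h|^2 <= (e n + e N) |h|. The Euler equation is exact at its limit. *)
Lemma real_riesz (phi : H -> R) (M : R) :
    (forall u v, phi (u + v) = phi u + phi v) ->
    (forall s u, phi (s%:C *: u) = s * phi u) ->
    (forall u, phi u <= M * rnorm u) ->
  exists z, forall x, phi x = rinner x z.
Proof.
move=> phiD phiZ phiM.
pose J u := rnorm u ^+ 2 - 2 * phi u.
have lbJ : has_lbound (range J).
  (* |u|^2 - 2 M |u| + M^2 is a square. *)
  exists (- M ^+ 2) => _ [u _ <-]; rewrite /J.
  have := phiM u; have := sqr_ge0 (rnorm u - M); rewrite sqrrB; lra.
have infJ : has_inf (range J) by split => //; exists (J 0), 0.
pose m := inf (range J).
have mJ u : m <= J u by apply: ge_inf => //; exists u.
pose e n : R := n.+1%:R^-1.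
have e_gt0 n : 0 < e n by rewrite invr_gt0.
have /choice[u hu] : forall n, exists x, J x <= m + e n ^+ 2.
  move=> n; have [_ [x _ <-] /ltW hx] := inf_adherent (exprn_gt0 2 (e_gt0 n)) infJ.
  by exists x.
have euler n h : `|rinner (u n) h - phi h| <= e n * rnorm h.
  by apply: (minimizer_Euler h phiD phiZ mJ (ltW (e_gt0 n)) (hu n)).
have e_small d : 0 < d -> exists N, forall n, (N <= n)%N -> e n <= d.
  move=> d0; have [N hN] : exists N, d^-1 <= N.+1%:R.
    by exists (Num.truncn d^-1); rewrite ltW // truncnS_gt.
  exists N => n Nn; rewrite /e -[d]invrK lef_pV2 ?posrE ?invr_gt0 //.
  by rewrite (le_trans hN) // ler_nat.
have [|z hz] := rnorm_cauchy_converges (u := u).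
  move=> d d0; have [N hN] := e_small (d / 2) (divr_gt0 d0 (ltr0Sn _ _)).
  exists N => n Nn; set h := u n - u N.
  have := rnorm_ge0 h; rewrite le0r => /orP[/eqP->|h0]; first exact: ltW.
  have : rnorm h ^+ 2 <= d * rnorm h.
    have := euler n h; have := euler N h; have := hN N (leqnn N).
    have := hN n Nn; rewrite -rinnerxx {5}/h rinnerDl rinnerNl !ler_norml.
    move=> h1 h2 /andP[h3 h4] /andP[h5 h6].
    have : e n * rnorm h <= d / 2 * rnorm h by rewrite ler_pM2r.
    have : e N * rnorm h <= d / 2 * rnorm h by rewrite ler_pM2r.
    lra.
  by rewrite expr2 ler_pM2r.
exists z => h; rewrite rinnerC; apply/eqP; rewrite eq_sym -subr_eq0 -normr_eq0.
rewrite eq_le normr_ge0 andbT.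
have K0 : 0 < 2 * (rnorm h + 1) by have := rnorm_ge0 h; lra.
apply/ler_addgt0Pr => d d0; rewrite add0r.
have c0 : 0 < d / (2 * (rnorm h + 1)) by exact: divr_gt0.
have [N1 h1] := hz _ c0; have [N2 h2] := e_small _ c0.
pose n := maxn N1 N2; have {}h1 := h1 n (leq_maxl _ _).
have {}h2 := h2 n (leq_maxr _ _); set c := d / _ in c0 h1 h2.
have dE : d = c * (2 * (rnorm h + 1)) by rewrite /c divfK // gt_eqF.
have -> : rinner z h - phi h = rinner (z - u n) h + (rinner (u n) h - phi h).
  by rewrite rinnerDl rinnerNl; ring.
apply: le_trans (ler_normD _ _) _.
have := le_trans (rinner_le (z - u n) h) (ler_wpM2r (rnorm_ge0 h) _).
rewrite rnormBC => /(_ _ h1).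
have := le_trans (euler n h) (ler_wpM2r (rnorm_ge0 h) h2).
by rewrite dE; lra.
Qed.

End Riesz.

(** * Bounded, self-adjoint and positive operators *)
Section BoundedOperatorTheory.
Context {R : realType} {H : hilbertType R}.
Implicit Types (A B C S T : H -> H).

Lemma linD A x y : linear A -> A (x + y) = A x + A y.
Proof. by move=> lA; rewrite -[x in LHS]scale1r lA scale1r. Qed.

Lemma lin0 A : linear A -> A 0 = 0.
Proof. by move=> lA; apply: (addrI (A 0)); rewrite -linD // !addr0. Qed.

Lemma linZ A a x : linear A -> A (a *: x) = a *: A x.
Proof. by move=> lA; rewrite -[a *: x]addr0 lA lin0 // addr0. Qed.

Lemma linN A x : linear A -> A (- x) = - A x.
Proof. by move=> lA; rewrite -scaleN1r linZ // scaleN1r. Qed.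

Lemma linB A x y : linear A -> A (x - y) = A x - A y.
Proof. by move=> lA; rewrite linD // linN. Qed.

Lemma bounded_operatorP A : bounded_operator A <->
  linear A /\ exists2 M : R, 0 < M & forall x, rnorm (A x) <= M * rnorm x.
Proof.
split=> [[lA [M hM]]|[lA [M _ hM]]]; split => //; last first.
  by exists M => x; rewrite !norm_rnormE -rmorphM lecR.
exists (`|M| + 1); first by rewrite ltr_wpDl.
move=> x; have := hM x; rewrite !norm_rnormE -rmorphM lecR => /le_trans; apply.
by rewrite ler_wpM2r ?rnorm_ge0 // (le_trans (ler_norm _)) // lerDl.
Qed.

Lemma bounded_operatorD A B :
  bounded_operator A -> bounded_operator B -> bounded_operator (A + B).
Proof.
move=> /bounded_operatorP[lA [M M0 hM]] /bounded_operatorP[lB [N N0 hN]].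
apply/bounded_operatorP; split=> [a u v|].
  by rewrite !fctE lA lB scalerDr addrACA.
exists (M + N); first exact: addr_gt0.
move=> x; rewrite !fctE mulrDl (le_trans (rnormD _ _)) //.
by rewrite lerD.
Qed.

Lemma bounded_operatorZ (a : R[i]) A :
  bounded_operator A -> bounded_operator (a *: A).
Proof.
move=> /bounded_operatorP[lA [M M0 hM]].
apply/bounded_operatorP; split=> [b u v|].
  by rewrite !fctE lA scalerDr !scalerA mulrC.
have a0 : 0 <= complex.Re `|a| by rewrite normc_def sqrtr_ge0.
exists ((complex.Re `|a| + 1) * M).
  by rewrite mulr_gt0 // ltr_wpDl.
move=> x; rewrite !fctE rnormZC -mulrA ler_pM ?rnorm_ge0 //.
by rewrite lerDl.
Qed.

Lemma bounded_operatorN A : bounded_operator A -> bounded_operator (- A).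
Proof. by rewrite -scaleN1r; exact: bounded_operatorZ. Qed.

Lemma bounded_operatorB A B :
  bounded_operator A -> bounded_operator B -> bounded_operator (A - B).
Proof. by move=> bA /bounded_operatorN; exact: bounded_operatorD. Qed.

Lemma bounded_operator_comp A B :
  bounded_operator A -> bounded_operator B -> bounded_operator (A \o B).
Proof.
move=> /bounded_operatorP[lA [M M0 hM]] /bounded_operatorP[lB [N N0 hN]].
apply/bounded_operatorP; split=> [a u v|]; first by rewrite /= lB lA.
exists (M * N); first exact: mulr_gt0.
by move=> x; rewrite /= -mulrA (le_trans (hM _)) // ler_pM2l.
Qed.

(** Both sides are C-linear in x, so their real parts determine them. *)
Lemma inner_of_rinner A x y z : linear A ->
  (forall x, rinner (A x) y = rinner x z) -> inner (A x) y = inner x z.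
Proof.
move=> lA h; move: x; apply: eq_Re_linear => // x.
  by rewrite linZ // linearZl_LR.
by rewrite linearZl_LR.
Qed.

(** The value of the adjoint at y represents the functional sending x to
the inner product of A x and y. *)
Lemma adjoint_exists A : bounded_operator A ->
  exists A', bounded_operator A' /\
             forall x y, inner (A x) y = inner x (A' y).
Proof.
move=> /bounded_operatorP[lA [M M0 hM]].
have /choice[A' hA'] : forall y, exists z, forall x, rinner (A x) y = rinner x z.
  move=> y; apply: (@real_riesz _ _ _ (M * rnorm y)) => [u v|s u|u].
  - by rewrite linD // rinnerDl.
  - by rewrite linZ // rinnerZl.
  - rewrite (le_trans (ler_norm _)) // (le_trans (rinner_le _ _)) //.
    by rewrite mulrAC ler_wpM2r ?rnorm_ge0.
have innerA' x y : inner (A x) y = inner x (A' y).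
  by apply: inner_of_rinner.
exists A'; split => //; apply/bounded_operatorP; split=> [a u v|].
  apply: rinner_inj => z; rewrite /rinner -innerA' !linearDr !linearZr_LR /=.
  by rewrite !innerA'.
exists M => // y; have := rnorm_ge0 (A' y); rewrite le0r => /orP[/eqP->|h0].
  by rewrite mulr_ge0 ?rnorm_ge0 // ltW.
rewrite -(ler_pM2r h0) -expr2 -rinnerxx -hA'.
rewrite (le_trans (ler_norm _)) // (le_trans (rinner_le _ _)) //.
by rewrite mulrAC ler_wpM2r ?rnorm_ge0.
Qed.

Lemma adjointP A : bounded_operator A -> bounded_operator (adjoint A) /\
  forall x y, inner (A x) y = inner x (adjoint A y).
Proof. by move=> /adjoint_exists /(xgetPex 0). Qed.

Lemma rinner_adjoint A x y : bounded_operator A ->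
  rinner (A x) y = rinner x (adjoint A y).
Proof. by move=> /adjointP[_ h]; rewrite /rinner h. Qed.

Lemma self_adjointP S : self_adjoint S <->
  bounded_operator S /\ forall x y, rinner (S x) y = rinner x (S y).
Proof.
split=> [[bS eS]|[bS hS]]; split=> //.
  by move=> x y; rewrite rinner_adjoint // eS.
apply/funext => y; apply: rinner_inj => x.
by rewrite -rinner_adjoint.
Qed.

(** Self-adjointness already makes the quadratic form real, so only the sign of
its real part matters. *)
Lemma positive_operatorP S : positive_operator S <->
  self_adjoint S /\ forall x, 0 <= rinner (S x) x.
Proof.
split=> -[sS hS]; split=> // x; have := hS x; rewrite lecE /=.
  by case/andP.
rewrite /rinner => ->; rewrite andbT.
have /self_adjointP[[lS _] symS] := sS.
have := inner_of_rinner x lS (fun z => symS z x).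
rewrite [inner x _]innerC; case: (inner _ _) => a b [] /=; lra.
Qed.

Lemma self_adjointD S T :
  self_adjoint S -> self_adjoint T -> self_adjoint (S + T).
Proof.
move=> /self_adjointP[bS hS] /self_adjointP[bT hT]; apply/self_adjointP.
split=> [|x y]; first exact: bounded_operatorD.
by rewrite !fctE rinnerDl rinnerDr hS hT.
Qed.

Lemma self_adjointZ (s : R) S : self_adjoint S -> self_adjoint (s%:C *: S).
Proof.
move=> /self_adjointP[bS hS]; apply/self_adjointP.
split=> [|x y]; first exact: bounded_operatorZ.
by rewrite !fctE rinnerZl rinnerZr hS.
Qed.

Lemma self_adjointB S T :
  self_adjoint S -> self_adjoint T -> self_adjoint (S - T).
Proof.
move=> sS sT; apply: self_adjointD => //.
have -> : - T = (-1)%:C *: T by rewrite rmorphN scaleN1r.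
exact: self_adjointZ.
Qed.

End BoundedOperatorTheory.

(** * The positive square root of C* C *)
Section SquareRoot.
Context {R : realType} {H : hilbertType R}.
Implicit Types (A C S T Z : H -> H) (Y : nat -> H -> H).

(** Convergence in operator norm, written without the operator norm itself. *)
Definition op_converges Y Z := forall e : R, 0 < e ->
  exists N, forall n, (N <= n)%N -> forall x, rnorm (Y n x - Z x) <= e * rnorm x.

Lemma op_cauchy_converges Y :
  (forall e : R, 0 < e -> exists N, forall n, (N <= n)%N ->
    forall x, rnorm (Y n x - Y N x) <= e * rnorm x) ->
  exists Z, op_converges Y Z.
Proof.
move=> hY.
have /choice[Z hZ] : forall x, exists z, converges (fun n => Y n x) z.
  move=> x; apply: rnorm_cauchy_converges => e e0.
  have x0 : 0 < rnorm x + 1 by rewrite ltr_wpDl ?rnorm_ge0.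
  have [N hN] := hY _ (divr_gt0 e0 x0).
  exists N => n /hN /(_ x) /le_trans; apply.
  by rewrite -mulrA ger_pMr // ler_pdivrMl // mulr1 lerDl.
exists Z => e e0; have [N hN] := hY (e / 2) (divr_gt0 e0 (ltr0Sn _ _)).
exists N => n Nn x; apply/ler_addgt0Pr => d d0.
have [M hM] := hZ x d d0.
pose k := maxn N M; have {}hM := hM k (leq_maxr _ _).
have hk := hN k (leq_maxl _ _) x; have {}hN := hN n Nn x.
have -> : Y n x - Z x = (Y n x - Y N x) + ((Y N x - Y k x) + (Y k x - Z x)).
  by rewrite !addrA !subrK.
rewrite (le_trans (rnormD _ _)) //.
have := rnormD (Y N x - Y k x) (Y k x - Z x); rewrite (rnormBC (Y N x)).
lra.
Qed.

Lemma op_converges_linear Y Z :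
  (forall n, linear (Y n)) -> op_converges Y Z -> linear Z.
Proof.
move=> lY YZ a u v; apply/eqP; rewrite -subr_eq0; apply/eqP.
pose a' := complex.Re `|a|.
have a'0 : 0 <= a' by rewrite /a' normc_def sqrtr_ge0.
apply: (@rnorm_eq0_small _ _ _ (rnorm (a *: u + v) + (a' * rnorm u + rnorm v))).
move=> e e0; have [N /(_ N (leqnn N)) hN] := YZ e e0.
have -> : Z (a *: u + v) - (a *: Z u + Z v) =
    - (Y N (a *: u + v) - Z (a *: u + v)) +
    (a *: (Y N u - Z u) + (Y N v - Z v)).
  by rewrite lY scalerBr opprB [X in _ = _ + X]addrACA -opprD addrA subrK.
rewrite (le_trans (rnormD _ _)) // rnormN mulrDr lerD //.
rewrite (le_trans (rnormD _ _)) // rnormZC mulrDr lerD //.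
by rewrite mulrCA ler_wpM2l.
Qed.

Lemma op_converges_sym Y Z :
    (forall n x y, rinner (Y n x) y = rinner x (Y n y)) -> op_converges Y Z ->
  forall x y, rinner (Z x) y = rinner x (Z y).
Proof.
move=> sY YZ x y; apply/eqP; rewrite -subr_eq0 -normr_eq0 eq_le normr_ge0 andbT.
have K0 : 0 < 2 * (rnorm x * rnorm y) + 1.
  by rewrite ltr_wpDl // !mulr_ge0 ?rnorm_ge0.
apply/ler_addgt0Pr => d d0; rewrite add0r.
have [N /(_ N (leqnn N)) hN] := YZ _ (divr_gt0 d0 K0).
set e := d / _ in hN; have dE : d = e * (2 * (rnorm x * rnorm y) + 1).
  by rewrite /e divfK // gt_eqF.
have e0 : 0 < e by rewrite divr_gt0.
have -> : rinner (Z x) y - rinner x (Z y) =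
    rinner x (Y N y - Z y) - rinner (Y N x - Z x) y.
  by rewrite rinnerDl rinnerDr rinnerNl rinnerNr sY; ring.
rewrite (le_trans (ler_normB _ _)) //.
have := le_trans (rinner_le _ _) (ler_wpM2l (rnorm_ge0 x) (hN y)).
have := le_trans (rinner_le _ _) (ler_wpM2r (rnorm_ge0 y) (hN x)).
by rewrite dE; lra.
Qed.

(** The successive approximations of the solution Z of 2 Z = A + Z^2, for which
(1 - Z)^2 = 1 - A. *)
Fixpoint sqrt_iter A n : H -> H :=
  if n is m.+1 then
    fun x => 2^-1%:C *: (A x + sqrt_iter A m (sqrt_iter A m x))
  else fun=> 0.

(** The same iteration for the scalar A = 1. It dominates, in norm, the
iterates for any contraction A as well as their successive differences. *)
Fixpoint sqrt_major n : R :=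
  if n is m.+1 then (1 + sqrt_major m ^+ 2) / 2 else 0.

Lemma sqrt_major_itv n : 0 <= sqrt_major n <= 1.
Proof.
elim: n => [|n /= /andP[h0 h1]]; first by rewrite lexx ler01.
have : sqrt_major n ^+ 2 <= 1 by rewrite expr_le1.
have := sqr_ge0 (sqrt_major n); lra.
Qed.

Lemma sqrt_major_nondecreasing : {homo sqrt_major : m n / (m <= n)%N >-> m <= n}.
Proof.
apply: homo_leq => [//|x y z|n]; first exact: le_trans.
by rewrite /=; have := sqr_ge0 (1 - sqrt_major n); lra.
Qed.

Lemma sqrt_major_cauchy (e : R) : 0 < e ->
  exists N, forall n, (N <= n)%N -> sqrt_major n - sqrt_major N <= e.
Proof.
move=> e0; have supy : has_sup (range sqrt_major).
  split; first by exists (sqrt_major 0), 0%N.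
  by exists 1 => _ [n _ <-]; case/andP: (sqrt_major_itv n).
have [_ [N _ <-] hN] := sup_adherent e0 supy.
exists N => n _; have : sqrt_major n <= sup (range sqrt_major).
  by apply: ub_le_sup; [case: supy | exists n].
lra.
Qed.

Section Iteration.
Variable A : H -> H.
Hypotheses (lA : linear A) (cA : forall x, rnorm (A x) <= rnorm x).
Hypothesis symA : forall x y, rinner (A x) y = rinner x (A y).
Local Notation Y := (sqrt_iter A).

Lemma sqrt_iterS n x : Y n.+1 x = 2^-1%:C *: (A x + Y n (Y n x)).
Proof. by []. Qed.

Lemma sqrt_iter_linear n : linear (Y n).
Proof.
elim: n => [a u v|n IH a u v] /=; first by rewrite scaler0 addr0.
rewrite lA IH IH [in RHS]scalerA [a * _]mulrC -!scalerA.
by rewrite -scalerDr; congr (_ *: _); rewrite scalerDr addrACA.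
Qed.

Lemma sqrt_iter_sym n x y : rinner (Y n x) y = rinner x (Y n y).
Proof.
elim: n x y => [|n IH] x y /=.
  by rewrite -[0](scaler0 _ (0%:C)) rinnerZl rinnerZr !mul0r.
by rewrite rinnerZl rinnerZr rinnerDl rinnerDr symA !IH.
Qed.

Lemma sqrt_iter_le n x : rnorm (Y n x) <= sqrt_major n * rnorm x.
Proof.
elim: n x => [|n IH] x /=; first by rewrite rnorm0 mul0r.
have /andP[y0 _] := sqrt_major_itv n.
have := rnormD (A x) (Y n (Y n x)); rewrite rnormZ gtr0_norm ?invr_gt0 //.
have := le_trans (IH (Y n x)) (ler_wpM2l y0 (IH x)); have := cA x.
lra.
Qed.

(** With Y' = Y n.+1 and Y = Y n, the next difference is half of
Y'^2 - Y^2 = Y' (Y' - Y) + (Y' - Y) Y, which needs no commutation; taking norms,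
the majorant obeys the same recursion because
y'^2 - y^2 = y' (y' - y) + (y' - y) y. *)
Lemma sqrt_iter_step n x :
  rnorm (Y n.+1 x - Y n x) <= (sqrt_major n.+1 - sqrt_major n) * rnorm x.
Proof.
elim: n x => [|n IH] x.
  rewrite subr0 (le_trans (sqrt_iter_le 1 x)) //=.
  by rewrite subr0.
have -> : Y n.+2 x - Y n.+1 x = 2^-1%:C *:
    (Y n.+1 (Y n.+1 x - Y n x) + (Y n.+1 (Y n x) - Y n (Y n x))).
  rewrite (sqrt_iterS n.+1 x) [X in _ - X]sqrt_iterS -scalerBr.
  rewrite (linB _ _ (sqrt_iter_linear n.+1)) addrA subrK.
  by rewrite opprD addrACA subrr add0r.
have /andP[y0 _] := sqrt_major_itv n; have /andP[y1 _] := sqrt_major_itv n.+1.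
rewrite rnormZ gtr0_norm ?invr_gt0 //.
have := rnormD (Y n.+1 (Y n.+1 x - Y n x)) (Y n.+1 (Y n x) - Y n (Y n x)).
have := le_trans (sqrt_iter_le n.+1 _) (ler_wpM2l y1 (IH x)).
have d0 : 0 <= sqrt_major n.+1 - sqrt_major n.
  by rewrite subr_ge0 sqrt_major_nondecreasing.
have := le_trans (IH (Y n x)) (ler_wpM2l d0 (sqrt_iter_le n x)).
have -> : sqrt_major n.+2 = (1 + sqrt_major n.+1 ^+ 2) / 2 by [].
have eqn : sqrt_major n.+1 * 2 = 1 + sqrt_major n ^+ 2 by rewrite /= divfK.
(* Since a = (1 + b^2) / 2, the increment (1 + a^2) / 2 - a is (a^2 - b^2) / 2. *)
set a := sqrt_major n.+1 in eqn *; set b := sqrt_major n in eqn *.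
move=> h1 h2 h3.
have -> : ((1 + a ^+ 2) / 2 - a) * rnorm x = 
  2^-1 * (a * ((a - b) * rnorm x) + (a - b) * (b * rnorm x)).
  have -> : (1 + a ^+ 2) / 2 - a = (2 + 2 * a ^+ 2 - 2 * (a * 2)) / 4 by field.
  by rewrite eqn; field.
rewrite ler_pM2l ?invr_gt0 //; lra.
Qed.

Lemma sqrt_iter_dist m n x : (m <= n)%N ->
  rnorm (Y n x - Y m x) <= (sqrt_major n - sqrt_major m) * rnorm x.
Proof.
elim: n => [|n IH]; first by rewrite leqn0 => /eqP ->; rewrite !subrr rnorm0 mul0r.
rewrite leq_eqVlt => /orP[/eqP ->|/IH {}IH]; first by rewrite !subrr rnorm0 mul0r.
have -> : Y n.+1 x - Y m x = (Y n.+1 x - Y n x) + (Y n x - Y m x).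
  by rewrite addrA subrK.
rewrite (le_trans (rnormD _ _)) //.
have := sqrt_iter_step n x; lra.
Qed.

(** The equation holds at the limit Z because it holds for Y N.+1 and Y N up to
errors controlled in operator norm; the factor 4 in the estimate counts 2 |x|
for 2 Z x and |x| for each of the two arguments of the product Z Z. *)
Lemma contraction_fixpoint : exists Z,
  [/\ self_adjoint Z, forall x, rnorm (Z x) <= rnorm x &
      forall x, 2%:C *: Z x = A x + Z (Z x)].
Proof.
have [|Z YZ] := @op_cauchy_converges Y.
  move=> e e0; have [N hN] := sqrt_major_cauchy e0.
  exists N => n Nn x; rewrite (le_trans (sqrt_iter_dist x Nn)) //.
  by rewrite ler_wpM2r ?rnorm_ge0 // hN.
have Y1 n x : rnorm (Y n x) <= rnorm x.
  have /andP[_ y1] := sqrt_major_itv n.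
  by rewrite (le_trans (sqrt_iter_le n x)) // ler_piMl ?rnorm_ge0.
have lZ := op_converges_linear sqrt_iter_linear YZ.
have Z1 x : rnorm (Z x) <= rnorm x.
  apply/ler_addgt0Pr => d d0.
  have x0 : 0 < rnorm x + 1 by rewrite ltr_wpDl ?rnorm_ge0.
  have [N /(_ N (leqnn N) x) hN] := YZ _ (divr_gt0 d0 x0).
  have -> : Z x = Y N x - (Y N x - Z x) by rewrite opprB addrC subrK.
  rewrite (le_trans (rnormD _ _)) // rnormN lerD // (le_trans hN) //.
  by rewrite -mulrA ger_pMr // ler_pdivrMl // mulr1 lerDl.
exists Z; split => //.
  apply/self_adjointP; split; last exact: (op_converges_sym sqrt_iter_sym YZ).
  by apply/bounded_operatorP; split => //; exists 1 => // x; rewrite mul1r.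
move=> x; apply/eqP; rewrite -subr_eq0; apply/eqP.
apply: (@rnorm_eq0_small _ _ _ (4 * rnorm x)) => e e0.
have [N hN] := YZ e e0; have hN1 := hN N.+1 (leqnSn N).
have {}hN := hN N (leqnn N).
have -> : 2%:C *: Z x - (A x + Z (Z x)) =
    (- (2%:C *: (Y N.+1 x - Z x))) +
    (Y N (Y N x - Z x) + (Y N (Z x) - Z (Z x))).
  rewrite (linB _ _ (sqrt_iter_linear N)) [X in _ = _ + X]addrA subrK.
  rewrite scalerBr opprB.
  have -> : 2%:C *: Y N.+1 x = A x + Y N (Y N x).
    by rewrite /= scalerA -rmorphM divff // scale1r.
  by rewrite !opprD !addrA subrK.
rewrite (le_trans (rnormD _ _)) // rnormN rnormZ normr_nat.
have := rnormD (Y N (Y N x - Z x)) (Y N (Z x) - Z (Z x)).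
have := le_trans (hN (Z x)) (ler_wpM2l (ltW e0) (Z1 x)).
have := le_trans (Y1 N _) (hN x); have := hN1 x; lra.
Qed.

End Iteration.

Lemma self_adjoint_id : self_adjoint (id : H -> H).
Proof.
apply/self_adjointP; split=> //; apply/bounded_operatorP; split=> //.
by exists 1 => // x; rewrite mul1r.
Qed.

(** The root is 1 - Z, where 2 Z = A + Z^2. It is positive because Z is a
self-adjoint contraction. *)
Lemma sqrt_complement A : linear A ->
    (forall x, rnorm (A x) <= rnorm x) ->
    (forall x y, rinner (A x) y = rinner x (A y)) ->
  exists S, positive_operator S /\ forall x, S (S x) = x - A x.
Proof.
move=> lA cA symA; have [Z [sZ Z1 ZE]] := contraction_fixpoint lA cA symA.
have [[lZ _] _] := sZ.
exists (id - Z); split.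
  apply/positive_operatorP; split; first exact: self_adjointB self_adjoint_id sZ.
  move=> x; rewrite !fctE rinnerDl rinnerNl subr_ge0 rinnerxx.
  rewrite (le_trans (ler_norm _)) // (le_trans (rinner_le _ _)) // expr2.
  by rewrite ler_wpM2r ?rnorm_ge0.
move=> x; rewrite !fctE linB //.
have -> : A x = 2%:C *: Z x - Z (Z x) by rewrite ZE addrK.
rewrite [2%:C](_ : _ = 1 + 1) ?scalerDl ?scale1r ?rmorphD //.
by rewrite !opprB opprD !addrA; congr (_ + _); rewrite addrAC.
Qed.

(** With M a bound for C and T = C* C, the operator A = 1 - T / M^2 is a
contraction:
|A x|^2 = |x|^2 - 2 |C x|^2 / M^2 + |T x|^2 / M^4 and |T x| <= M |C x|.
Hence 1 - A = T / M^2 has a positive root, and M times it is a root of T. *)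
Lemma sqrt_exists C : bounded_operator C ->
  exists S, positive_operator S /\ S \o S = adjoint C \o C.
Proof.
move=> bC; have [bC' _] := adjointP bC.
have /bounded_operatorP[lC [M M0 hM]] := bC.
set T := adjoint C \o C.
have bT : bounded_operator T by exact: bounded_operator_comp.
have lT := bT.1.
have TE x y : rinner (T x) y = rinner (C x) (C y).
  by rewrite [LHS]rinnerC [RHS]rinnerC rinner_adjoint.
have hT x : rnorm (T x) <= M * rnorm (C x).
  have := rnorm_ge0 (T x); rewrite le0r => /orP[/eqP->|h0].
    by rewrite mulr_ge0 ?rnorm_ge0 // ltW.
  rewrite -(ler_pM2r h0) -expr2 -rinnerxx TE.
  rewrite (le_trans (ler_norm _)) // (le_trans (rinner_le _ _)) //.
  by rewrite mulrAC mulrC ler_wpM2r ?rnorm_ge0.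
pose A := id - (M ^- 2)%:C *: T.
have AE x : A x = x - (M ^- 2)%:C *: T x by [].
have bA : bounded_operator A.
  by apply: bounded_operatorB; [exact: self_adjoint_id.1|exact: bounded_operatorZ].
have [||S [pS hS]] := @sqrt_complement A bA.1.
- move=> x; rewrite -ler_sqr ?nnegrE ?rnorm_ge0 // AE -rinnerxx.
  rewrite rinnerDl !rinnerDr !rinnerNl !rinnerNr !rinnerZl !rinnerZr.
  rewrite [rinner x (T x)]rinnerC TE !rinnerxx.
  have M2 : 0 < M ^- 2 by rewrite invr_gt0 exprn_gt0.
  have hT2 : M ^- 2 * rnorm (T x) ^+ 2 <= rnorm (C x) ^+ 2.
    rewrite ler_pdivrMl ?exprn_gt0 // -exprMn.
    by rewrite ler_sqr ?nnegrE ?mulr_ge0 ?rnorm_ge0 // ltW.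
  have := mulr_ge0 (ltW M2) (sqr_ge0 (rnorm (C x))).
  have := ler_wpM2l (ltW M2) hT2; lra.
- move=> x y; rewrite !AE !rinnerDl !rinnerDr !rinnerNl !rinnerNr.
  by rewrite !rinnerZl !rinnerZr TE [rinner x (T y)]rinnerC TE rinnerC (rinnerC (C x)).
have /positive_operatorP[sS posS] := pS.
exists (M%:C *: S); split.
  apply/positive_operatorP; split; first exact: self_adjointZ.
  by move=> x; rewrite !fctE rinnerZl mulr_ge0 // ltW.
apply/funext => x; rewrite /= !fctE (linZ _ _ sS.1.1) scalerA hS AE.
rewrite opprB addrC subrK scalerA -!rmorphM /= -expr2 mulfV ?expf_neq0 ?gt_eqF //.
by rewrite scale1r.
Qed.

(** Existence of a root is enough: whichever positive root the absolute value
selects, its square is C* C. *)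
Lemma sqr_abs_operator C : bounded_operator C ->
  sqr_operator (abs_operator C) = adjoint C \o C.
Proof. by move=> /sqrt_exists /(xgetPex 0) []. Qed.

End SquareRoot.

(** * The operator inequality *)
Section Inequality.
Context {R : realType} {H : hilbertType R}.
Implicit Types (A B C : H -> H).

Lemma self_adjoint_sqr_abs C :
  bounded_operator C -> self_adjoint (sqr_operator (abs_operator C)).
Proof.
move=> bC; rewrite sqr_abs_operator //; apply/self_adjointP; split.
  by apply: bounded_operator_comp => //; case: (adjointP bC).
move=> x y /=; rewrite -(rinner_adjoint x _ bC) rinnerC.
by rewrite -(rinner_adjoint _ _ bC) rinnerC.
Qed.

Lemma rinner_sqr_abs C x : bounded_operator C ->
  rinner (sqr_operator (abs_operator C) x) x = rnorm (C x) ^+ 2.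
Proof.
move=> bC; rewrite sqr_abs_operator //= rinnerC -(rinner_adjoint _ _ bC).
by rewrite rinnerxx.
Qed.

Lemma operator_leP S T : self_adjoint S -> self_adjoint T ->
  (forall x : H, rinner (S x) x <= rinner (T x) x) -> operator_le S T.
Proof.
move=> sS sT h; split => //; apply/positive_operatorP.
split=> [|x]; first exact: self_adjointB.
by rewrite !fctE rinnerDl rinnerNl subr_ge0.
Qed.

(** Completing the square in t a + b: the two ranges of t in the theorem are
told apart by the sign of (1 - t) / t alone. *)
Lemma sqr_rnorm_defect (t : R) (a b : H) : t != 0 ->
  (1 + t) * rnorm a ^+ 2 + (1 + 1 / t) * rnorm b ^+ 2
    - (rnorm (a - b) ^+ 2 + rnorm (t%:C *: a + b) ^+ 2)
  = (1 - t) / t * rnorm (t%:C *: a + b) ^+ 2.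
Proof.
move=> t0; rewrite !rnormD_sqr rnormN rnormZ exprMn real_normK ?num_real //.
by rewrite rinnerNr rinnerZl; field.
Qed.

Lemma operator_inequality (t : R) A B :
    bounded_operator A -> bounded_operator B ->
  (0 < t <= 1 ->
     operator_le
       (sqr_operator (abs_operator (A - B)) +
        sqr_operator (abs_operator (t%:C *: A + B)))
       ((1 + t)%:C *: sqr_operator (abs_operator A) +
        (1 + 1 / t)%:C *: sqr_operator (abs_operator B)))
  /\
  (1 <= t \/ t < 0 ->
     operator_le
       ((1 + t)%:C *: sqr_operator (abs_operator A) +
        (1 + 1 / t)%:C *: sqr_operator (abs_operator B))
       (sqr_operator (abs_operator (A - B)) +
        sqr_operator (abs_operator (t%:C *: A + B)))).
Proof.
move=> bA bB.
have bD := bounded_operatorB bA bB.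
have bE := bounded_operatorD (bounded_operatorZ t%:C bA) bB.
have sL := self_adjointD (self_adjoint_sqr_abs bD) (self_adjoint_sqr_abs bE).
have sR := self_adjointD (self_adjointZ (1 + t) (self_adjoint_sqr_abs bA))
                         (self_adjointZ (1 + 1 / t) (self_adjoint_sqr_abs bB)).
split=> ht; apply: operator_leP => // x;
  rewrite !fctE !rinnerDl !rinnerZl !rinner_sqr_abs //=.
  case/andP: ht => t0 t1; rewrite -subr_ge0 sqr_rnorm_defect ?gt_eqF //.
  by rewrite mulr_ge0 ?sqr_ge0 // divr_ge0 ?subr_ge0 // ltW.
have [t0 c0] : t != 0 /\ (1 - t) / t <= 0.
  case: ht => [t1|t0].
    have t0 : 0 < t by lra.
    by rewrite gt_eqF // ler_pdivrMr // mul0r subr_le0.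
  by rewrite lt_eqF // ler_ndivrMr // mul0r subr_ge0; split=> //; lra.
rewrite -subr_le0 sqr_rnorm_defect //.
by rewrite mulr_le0_ge0 // sqr_ge0.
Qed.

Lemma sqr_abs_operatorN C : bounded_operator C ->
  sqr_operator (abs_operator (- C)) = sqr_operator (abs_operator C).
Proof.
move=> bC; have bN := bounded_operatorN bC; rewrite !sqr_abs_operator //.
apply/funext => x; apply: rinner_inj => z /=.
rewrite -(rinner_adjoint _ _ bC) -(rinner_adjoint _ _ bN) !fctE.
by rewrite rinnerNl rinnerNr opprK.
Qed.
End Inequality.

Theorem theorem2p2 (R : realType) (H : hilbertType R) (sepH : separable_space H)
    (t : R) (A B : H -> H)
    (bA : bounded_operator A) (bB : bounded_operator B) :
  (0 < t <= 1 ->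
     operator_le
       (sqr_operator (abs_operator (A - B)) +
        sqr_operator (abs_operator (t%:C *: A + B)))
       ((1 + t)%:C *: sqr_operator (abs_operator A) +
        (1 + 1 / t)%:C *: sqr_operator (abs_operator B))
     /\
     operator_le
       (sqr_operator (abs_operator (A + B)) +
        sqr_operator (abs_operator (t%:C *: A - B)))
       ((1 + t)%:C *: sqr_operator (abs_operator A) +
        (1 + 1 / t)%:C *: sqr_operator (abs_operator B)))
  /\
  (1 <= t \/ t < 0 ->
     operator_le
       ((1 + t)%:C *: sqr_operator (abs_operator A) +
        (1 + 1 / t)%:C *: sqr_operator (abs_operator B))
       (sqr_operator (abs_operator (A - B)) +
        sqr_operator (abs_operator (t%:C *: A + B)))
     /\
     operator_le
       ((1 + t)%:C *: sqr_operator (abs_operator A) +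
        (1 + 1 / t)%:C *: sqr_operator (abs_operator B))
       (sqr_operator (abs_operator (A + B)) +
        sqr_operator (abs_operator (t%:C *: A - B)))).
Proof.
(* The lower signs are the upper ones for the pair (A, - B). *)
have [le1 ge1] := operator_inequality t bA bB.
have [] := operator_inequality t bA (bounded_operatorN bB).
rewrite opprK sqr_abs_operatorN // => le2 ge2.
by split=> ht; split; auto.
Qed.
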